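(* Let $m\ge 2$ be a fixed integer. Let $f$ be a probability density function on $\nabla_{m-1}$ such that $f$ is bounded and continuous on the closure $\overline{\nabla}_{m-1}$. For each $n$ let $\kappa=(k_1,\ldots,k_m)\in\mathcal{P}_n(m)$ be chosen with probability $$P_n(\kappa)=c\cdot f\Big(\frac{k_1}{n},\ldots,\frac{k_m}{n}\Big),\qquad c=c_{n,m}=\Big(\sum_{(k_1,\ldots,k_m)\in\mathcal{P}_n(m)}f\Big(\frac{k_1}{n},\ldots,\frac{k_m}{n}\Big)\Big)^{-1}.$$ Then, as $n\to\infty$, $\big(\frac{k_1}{n},\ldots,\frac{k_m}{n}\big)$ converges weakly to the probability measure $\mu$ with density function $f(y_1,\ldots,y_m)$ on $\nabla_{m-1}$.
   Context: For integers $n,m\ge 1$, $\mathcal{P}_n(m)$ denotes the set of partitions of $n$ with at most $m$ parts; its elements are written as $\kappa=(k_1,\ldots,k_m)$ with integers $k_1\ge k_2\ge\cdots\ge k_m\ge 0$ and $\sum_{i=1}^m k_i=n$ (shorter partitions are padded with zeros). The ordered $(m-1)$-dimensional simplex is $$\nabla_{m-1}=\Big\{(y_1,\ldots,y_m)\in[0,1]^m;\ y_1>y_2>\cdots>y_{m-1}>y_m\ \text{ and }\ y_m=1-\sum_{i=1}^{m-1}y_i\Big\},$$ and $\overline{\nabla}_{m-1}$ is its closure. Densities on $\nabla_{m-1}$ are with respect to Lebesgue measure $dy_1\cdots dy_{m-1}$ in the first $m-1$ coordinates (with $y_m=1-\sum_{i=1}^{m-1}y_i$), so that $\int_{\nabla_{m-1}}f(y_1,\ldots,y_m)\,dy_1\cdots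 dy_{m-1}=1$. The measure $P_n$ is considered for those $n$ for which the normalizing sum is positive, which is the case for all sufficiently large $n$. *)

(* Defs.v *)
From HB Require Import structures.
From mathcomp Require Import all_boot all_order all_algebra.
From mathcomp Require Import all_classical all_reals all_analysis.

Set Implicit Arguments.
Unset Strict Implicit.
Unset Printing Implicit Defensive.

Import Order.TTheory GRing.Theory Num.Theory numFieldNormedType.Exports.

Local Open Scope classical_set_scope.
Local Open Scope ring_scope.

(* Lebesgue measure on R^k, seen as k.-tuple R: the iterated product of the
   one-dimensional Lebesgue measure. *)
Section lebesgue_measure_tuple.
Context {R : realType}.

Definition cons_pair k (p : measurableTypeR R * k.-tuple R) : k.+1.-tuple R :=
  [the k.+1.-tuple R of p.1 :: p.2].

Fixpoint lebesgue_tuple (k : nat) : set (k.-tuple R) -> \bar R :=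
  match k with
  | 0 => \d_[tuple]
  | k.+1 => pushforward (lebesgue_measure \x @lebesgue_tuple k)%E (@cons_pair k)
  end.

Let measurable_cons_pair k : measurable_fun setT (@cons_pair k).
Proof. exact: measurable_cons. Qed.

Let uncons k (t : k.+1.-tuple R) : measurableTypeR R * k.-tuple R :=
  (thead t, [tuple of behead t]).

Let cons_pairK k : cancel (@cons_pair k) (@uncons k).
Proof. by move=> [x t]; congr pair; apply/val_inj. Qed.

Let measurable_uncons k : measurable_fun setT (@uncons k).
Proof.
apply/measurable_fun_pairP; split; first exact: measurable_tnth.
exact: measurable_behead.
Qed.

Let step_sigma_finite k
    (M : {sigma_finite_measure set (k.-tuple R) -> \bar R}) :
  sigma_finite setT
    (pushforward (lebesgue_measure \x M)%E (@cons_pair k)).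
Proof.
have /sigma_finiteP[F [TF ndF Foo]] :=
  sigma_finiteT (@lebesgue_measure R).
have /sigma_finiteP[G [TG ndG Goo]] := sigma_finiteT M.
exists (fun n => @uncons k @^-1` (F n `*` G n)).
  apply/seteqP; split=> // t _.
  have : setT (thead t) by []. rewrite TF => -[i _ Fi].
  have : setT [tuple of behead t] by []. rewrite TG => -[j _ Gj].
  exists (maxn i j) => //; split => /=.
    by move: Fi; exact/subsetPset/ndF/leq_maxl.
  by move: Gj; exact/subsetPset/ndG/leq_maxr.
move=> n; have [? ?] := Foo n; have [? ?] := Goo n; split.
  rewrite -[X in measurable X]setTI; apply: measurable_uncons => //.
  exact: measurableX.
rewrite /pushforward (_ : _ @^-1` _ = F n `*` G n).
  by rewrite product_measure1E// lte_mul_pinfty// ge0_fin_numE.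
by rewrite -comp_preimage (_ : _ \o _ = id)//; exact/funext/cons_pairK.
Qed.

Let lebesgue_tuple_ex k :
  exists M : {sigma_finite_measure set (k.-tuple R) -> \bar R},
    @lebesgue_tuple k = M.
Proof.
elim: k => [|k [M /= ->]]; first by exists \d_[tuple].
pose nu : {measure set _ -> \bar R} :=
  measure_function_pushforward__canonical__measure_function_Measure
    (lebesgue_measure \x M)%E (@measurable_cons_pair k).
pose N : {sigma_finite_measure set (k.+1.-tuple R) -> \bar R} :=
  HB.pack (Measure.sort nu) (Measure.class nu)
    (@Measure_isSigmaFinite.Build _ _ _ nu (step_sigma_finite M)).
by exists N.
Qed.

Let lebesgue_tuple0 k : @lebesgue_tuple k set0 = 0%E.
Proof. by have [M ->] := lebesgue_tuple_ex k; rewrite measure0. Qed.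

Let lebesgue_tuple_ge0 k A : (0 <= @lebesgue_tuple k A)%E.
Proof. by have [M ->] := lebesgue_tuple_ex k. Qed.

Let lebesgue_tuple_sigma_additive k : semi_sigma_additive (@lebesgue_tuple k).
Proof.
by have [M ->] := lebesgue_tuple_ex k; exact: measure_semi_sigma_additive.
Qed.

HB.instance Definition _ k := isMeasure.Build _ _ _ (@lebesgue_tuple k)
  (@lebesgue_tuple0 k) (@lebesgue_tuple_ge0 k)
  (@lebesgue_tuple_sigma_additive k).

Let lebesgue_tuple_sigma_finite k : sigma_finite setT (@lebesgue_tuple k).
Proof. by have [M ->] := lebesgue_tuple_ex k; exact: sigma_finiteT. Qed.

HB.instance Definition _ k := @Measure_isSigmaFinite.Build _ _ _
  (@lebesgue_tuple k) (@lebesgue_tuple_sigma_finite k).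

End lebesgue_measure_tuple.

Notation borel T := (g_sigma_algebraType (@open T)).

(* Weak convergence of measures on the Borel sets of T. *)
Definition weak_cvg {R : realType} {T : ptopologicalType}
    (mu : (set (borel T) -> \bar R)^nat) (nu : set (borel T) -> \bar R) :=
  forall g : T -> R, continuous g -> bounded_fun g ->
    (\int[mu n]_x (g x)%:E)%E @[n --> \oo] --> (\int[nu]_x (g x)%:E)%E.

Section ordered_simplex.
Context {R : realType} (m : nat).

Definition nabla : set 'rV[R]_m :=
  [set y | [/\ forall i, 0 <= y 0 i <= 1,
               forall i j : 'I_m, (i < j)%N -> y 0 j < y 0 i &
               \sum_i y 0 i = 1]].

(* The point with first m-1 coordinates t and last coordinate 1 - \sum_i t_i:
   position m.-1 lies past the end of t, so it gets the default of nth. *)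
Definition simplex_point (t : m.-1.-tuple R) : 'rV[R]_m :=
  \row_i nth (1 - \sum_(x <- t) x) t i.

Definition nabla_chart : set (m.-1.-tuple R) := simplex_point @^-1` nabla.

Definition is_simplex_density (f : 'rV[R]_m -> R) :=
  [/\ measurable_fun nabla_chart (f \o simplex_point),
      forall y, nabla y -> 0 <= f y &
      (\int[@lebesgue_tuple R m.-1]_(t in nabla_chart)
         (f (simplex_point t))%:E = 1)%E].

Definition simplex_law (f : 'rV[R]_m -> R) (A : set (borel 'rV[R]_m)) :
    \bar R :=
  (\int[@lebesgue_tuple R m.-1]_(t in nabla_chart `&` simplex_point @^-1` A)
     (f (simplex_point t))%:E)%E.

End ordered_simplex.

(* A part of a partition of n is at most n, hence the type 'I_n.+1 of parts. *)
Definition partitions (n m : nat) : {set m.-tuple 'I_n.+1} :=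
  [set k : m.-tuple 'I_n.+1 | sorted geq [seq val i | i <- k] &
                              \sum_(i < m) tnth k i == n]%N%SET.

Section partition_law.
Context {R : realType} (m : nat) (f : 'rV[R]_m -> R) (n : nat).

Definition normalized_parts (k : m.-tuple 'I_n.+1) : 'rV[R]_m :=
  \row_i ((tnth k i)%:R / n%:R).

Definition partition_normalizer : R :=
  (\sum_(k in partitions n m) f (normalized_parts k))^-1.

Definition partition_prob (k : m.-tuple 'I_n.+1) : R :=
  partition_normalizer * f (normalized_parts k).

(* The law of normalized_parts k when k is drawn from partitions n m with
   probability partition_prob k.  When the sum in partition_normalizer
   vanishes, which concerns only finitely many n for f continuous of integral
   1, this is the zero measure. *)
Definition partition_law (A : set (borel 'rV[R]_m)) : \bar R :=
  (\sum_(k in partitions n m)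
     (partition_prob k)%:E * \d_(normalized_parts k : borel 'rV[R]_m) A)%E.

End partition_law.

(* Main.v *)
(* Idea: write m = p + 1 and use the first p coordinates as chart.  Cut R^p into
   cubes of side 1/N and, for F continuous on the closed simplex, let the step
   function h_N be F(k/N) on the cube with lower corner (k_1, ..., k_p)/N when
   k is a partition of N, and 0 on the other cubes.  Its integral is N^-p times
   the sum of F(k/N) over the partitions, and it converges to F off the
   hyperplanes y_i = y_j, which are null.  Dominated convergence then gives the
   limit of the normalized sums, and the expectation of g under P_n is the
   quotient of the sums for F = g f and F = f, the latter tending to 1. *)
From HB Require Import structures.
Require Import Defs.
From mathcomp Require Import all_boot all_order all_algebra.
From mathcomp Require Import all_classical all_reals all_analysis.
From mathcomp Require Import measurable_realfun ring lra.

Set Implicit Arguments.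
Unset Strict Implicit.
Unset Printing Implicit Defensive.

Import Order.TTheory GRing.Theory Num.Theory numFieldNormedType.Exports.

Local Open Scope classical_set_scope.
Local Open Scope ring_scope.

(** * Image under a map of a measure with density *)

Section density.
Context d1 d2 (X : measurableType d1) (Y : measurableType d2) (R : realType).
Local Open Scope ereal_scope.
Variables (mu : {measure set X -> \bar R}) (phi : X -> Y) (D : set X).
Variable w : X -> R.
Hypotheses (mphi : measurable_fun setT phi) (mD : measurable D).
Hypotheses (mw : measurable_fun D w) (w0 : forall x, D x -> (0 <= w x)%R).

(** [simplex_law] is the instance where [phi] is the chart [simplex_point], [D] its domain and [w]
    the density read in the chart. *)
Definition density_image (A : set Y) := \int[mu]_(x in D `&` phi @^-1` A) (w x)%:E.

Let mphiV (A : set Y) : measurable A -> measurable (D `&` phi @^-1` A).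
Proof.
by move=> mA; apply: measurableI => //; rewrite -[_ @^-1` _]setTI; exact: mphi.
Qed.

Let density_image0 : density_image set0 = 0.
Proof. by rewrite /density_image preimage_set0 setI0 integral_set0. Qed.

Let density_image_ge0 A : 0 <= density_image A.
Proof. by apply: integral_ge0 => x [Dx _]; rewrite lee_fin w0. Qed.

Let density_image_sigma_additive : semi_sigma_additive density_image.
Proof.
move=> F mF tF mUF.
have -> : density_image (\bigcup_n F n) = \sum_(n <oo) density_image (F n).
  rewrite /density_image preimage_bigcup setI_bigcupr ge0_integral_bigcup//.
  - by move=> n; exact: mphiV.
  - apply: (measurable_funS mD); last exact/measurable_EFinP.
    by apply: bigcup_sub => n _; exact: subIsetl.
  - by move=> x [n _ [Dx _]]; rewrite lee_fin w0.
  - apply/trivIsetP => i j _ _ ij; rewrite setIACA setIid -preimage_setI.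
    by move/trivIsetP : tF => ->//; rewrite preimage_set0 setI0.
by apply: is_cvg_nneseries => n _ _; exact: density_image_ge0.
Qed.

HB.instance Definition _ := isMeasure.Build _ _ _ density_image
  density_image0 density_image_ge0 density_image_sigma_additive.

Import HBNNSimple.

(** Standard approximation: monotone convergence on both sides reduces [g] to the simple functions
    [h n], and finite additivity reduces these to indicators of level sets. *)
Lemma ge0_integral_density_image (g : Y -> \bar R) :
    measurable_fun setT g -> (forall y, 0 <= g y) ->
  \int[density_image]_y g y = \int[mu]_(x in D) (g (phi x) * (w x)%:E).
Proof.
move=> mg g0; pose h := nnsfun_approx measurableT mg.
have gE y : (h n y)%:E @[n --> \oo] --> g y by exact: cvg_nnsfun_approx.
have mh n : measurable_fun D (fun x => (h n (phi x))%:E).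
  by apply/measurable_EFinP/measurable_funTS; exact: measurableT_comp.
transitivity (limn (fun n => \int[density_image]_y (h n y)%:E)).
  rewrite -monotone_convergence//.
  - by apply: eq_integral => y _; apply/esym/cvg_lim => //; exact: gE.
  - by move=> n; apply/measurable_EFinP.
  - by move=> n y _; rewrite lee_fin.
  - by move=> y _ a b ab; rewrite lee_fin; exact/lefP/nd_nnsfun_approx.
transitivity (limn (fun n => \int[mu]_(x in D) ((h n (phi x))%:E * (w x)%:E))); last first.
  rewrite -monotone_convergence//.
  - apply: eq_integral => x /[!inE] Dx; apply/cvg_lim => //.
    by apply: cvgeZr => //; exact: gE.
  - by move=> n; by apply: emeasurable_funM => //; exact/measurable_EFinP.
  - by move=> n x Dx; rewrite mule_ge0 ?lee_fin ?w0.
  - move=> x Dx a b ab; rewrite lee_wpmul2r ?lee_fin ?w0//.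
    exact/lefP/nd_nnsfun_approx.
congr (limn _); apply/funext => n.
pose k := h n.
transitivity (\sum_(r \in range k) \int[density_image]_y (r * \1_(k @^-1` [set r]) y)%:E).
  rewrite -ge0_integral_fsum//.
  - by apply: eq_integral => y _; rewrite fsumEFin// -fimfunE.
  - by move=> r; apply/measurable_EFinP; exact: measurable_funM.
  - by move=> r y _; exact: nnfun_muleindic_ge0.
transitivity (\sum_(r \in range k) \int[mu]_(x in D)
    ((r * \1_(k @^-1` [set r]) (phi x))%:E * (w x)%:E)); last first.
  rewrite -ge0_integral_fsum//.
  - apply: eq_integral => x _.
    rewrite -ge0_mule_fsuml; last by move=> r; exact: nnfun_muleindic_ge0.
    by rewrite fsumEFin// -fimfunE.
  - move=> r; apply: emeasurable_funM; apply/measurable_EFinP => //.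
    by apply: measurable_funM => //; exact/measurable_funTS/measurableT_comp.
  - by move=> r x Dx; rewrite mule_ge0 ?lee_fin ?w0//; 
    exact: nnfun_muleindic_ge0.
apply: eq_fsbigr => r /[!inE] -[y _ yr].
have r0 : (0 <= r)%R by rewrite -yr.
under [LHS]eq_integral do rewrite EFinM.
under [RHS]eq_integral do rewrite EFinM -muleA.
rewrite ge0_integralZl//; last exact/measurable_EFinP.
rewrite integral_indic// setIT.
rewrite ge0_integralZl//; last 2 first.
- apply: emeasurable_funM; apply/measurable_EFinP => //.
  exact/measurable_funTS/measurableT_comp.
- by move=> x Dx; rewrite mule_ge0// lee_fin// w0.
(* By definition of [density_image], the left side is the integral of [w] over the part of [D] that
   [phi] sends to the level set. *)
congr (_ * _); rewrite [LHS]integral_mkcondr; apply: eq_integral => x _.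
by rewrite epatch_indic muleC.
Qed.

(** Since [w] is nonnegative on [D], multiplying by it commutes with taking positive and negative
    parts. *)
Lemma integral_density_image (g : Y -> R) : measurable_fun setT g ->
  \int[density_image]_y (g y)%:E = \int[mu]_(x in D) (g (phi x) * w x)%:E.
Proof.
move=> mg; have mG : measurable_fun setT (EFin \o g) by exact/measurable_EFinP.
rewrite [LHS]integralE [RHS]integralE.
rewrite !ge0_integral_density_image//; last 2 first.
- exact: measurable_funeneg.
- exact: measurable_funepos.
by congr (_ - _); apply: eq_integral => x /[!inE] Dx;
  rewrite !(funeposE, funenegE) /= -?mulNr EFinM maxe_pMl ?lee_fin ?w0// mul0e.
Qed.

End density.

(** * Integration against a finite combination of Dirac masses *)

Section finite_law.
Context d (Y : measurableType d) (R : realType) (I : finType).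
Local Open Scope ereal_scope.

Lemma integral_finite_law (P : {set I}) (c : I -> R) (a : I -> Y) (g : Y -> R) :
    (forall i, i \in P -> (0 <= c i)%R) -> measurable_fun setT g ->
  \int[fun A => \sum_(i in P) (c i)%:E * \d_(a i) A]_y (g y)%:E =
  (\sum_(i in P) c i * g (a i))%:E.
Proof.
move=> c0 mg.
(* The empty sum is treated apart, since enumerating [P] by natural numbers takes a default element
   [i0]. *)
have [->|[i0 i0P]] := set_0Vmem P.
  rewrite big_set0 (_ : (fun _ => _) = mzero); first exact: integral_measure_zero.
  by apply/funext => A; rewrite big_set0.
pose e k := nth i0 (enum P) k.
(* [mscale] asks for a nonnegative scalar at every natural [k]; by [ce], the maximum with 0 changes
   nothing at indices below [#|P|]. *)
have cE k : (0 <= Num.max 0 (c (e k)))%R by rewrite le_max lexx.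
pose m_ k : {measure set Y -> \bar R} := mscale (NngNum (cE k)) \d_(a (e k)).
have eP (V : nmodType) (F : I -> V) : (\sum_(i in P) F i = \sum_(k < #|P|) F (e k))%R.
  by rewrite -big_enum/= (big_nth i0) big_mkord -cardE.
have ce (k : 'I_#|P|) : Num.max 0%R (c (e k)) = c (e k).
  by apply/max_idPr/c0; rewrite -mem_enum mem_nth// -cardE.
have -> : (fun A => \sum_(i in P) (c i)%:E * \d_(a i) A) = msum m_ #|P|.
  apply/funext => A; rewrite eP /msum; apply: eq_bigr => k _.
  by rewrite /= /mscale/= ce.
have intm (h : Y -> R) : measurable_fun setT h -> (forall y, 0 <= h y)%R ->
    \int[msum m_ #|P|]_y (h y)%:E = (\sum_(i in P) c i * h (a i))%:E.
  move=> mh h0; rewrite ge0_integral_measure_sum//; last 2 first.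
  - by move=> y _; rewrite lee_fin.
  - exact/measurable_EFinP.
  rewrite eP -sumEFin; apply: eq_bigr => k _.
  rewrite ge0_integral_mscale//; last 2 first.
  - exact/measurable_EFinP.
  - by move=> y _; rewrite lee_fin.
  rewrite integral_dirac//; last exact/measurable_EFinP.
  by rewrite diracT mul1e /= ce.
rewrite integralE.
rewrite (_ : (fun y => (g y)%:E)^\+ = (fun y => (g^\+%R y)%:E)); last first.
  by apply/funext => y; rewrite funeposE /= /funrpos EFin_max.
rewrite (_ : (fun y => (g y)%:E)^\- = (fun y => (g^\-%R y)%:E)); last first.
  by apply/funext => y; rewrite funenegE /= /funrneg EFin_max EFinN.
rewrite intm; last 2 first.
- exact: measurable_funrpos.
- exact: funrpos_ge0.
rewrite intm; last 2 first.
- exact: measurable_funrneg.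
- exact: funrneg_ge0.
rewrite -EFinB -sumrB; congr EFin; apply: eq_bigr => i _.
by rewrite -mulrBr; congr *%R; rewrite -[in RHS](funrposBneg g).
Qed.

End finite_law.

(** * Lebesgue measure on tuples: cubes and null sets *)

Section lebesgue_tuple_theory.
Context {R : realType}.
Implicit Types (k : nat).

Lemma measurable_cons_pair k : measurable_fun setT (@cons_pair R k).
Proof. exact: measurable_cons. Qed.

Lemma measurable_box k (B : 'I_k -> set R) : (forall i, measurable (B i)) ->
  measurable [set t : k.-tuple R | forall i, B i (tnth t i)].
Proof.
move=> mB; rewrite [X in measurable X](_ : _ =
    \bigcap_(i in setT) ((@tnth k R)^~ i @^-1` B i)).
  apply: fin_bigcap_measurable => // i _; rewrite -[_ @^-1` _]setTI.
  exact: measurable_tnth.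
by apply/seteqP; split => t Bt i; [move=> _|]; exact: Bt.
Qed.

(** Induction on [k]: [cons_pair] pulls the box back to the product of its first side and a box of
    dimension [k]. The sides may differ by translation, as those of a grid cell do. *)
Lemma lebesgue_tuple_cube k (B : 'I_k -> set R) (c : R) :
    (forall i, measurable (B i)) ->
    (forall i, lebesgue_measure (B i) = c%:E) ->
  lebesgue_tuple [set t : k.-tuple R | forall i, B i (tnth t i)] = (c ^+ k)%:E.
Proof.
elim: k B => [|k IH] B mB Bc.
  by rewrite /= diracE mem_set//= => -[].
rewrite /= /pushforward (_ : _ @^-1` _ = B ord0 `*`
    [set t : k.-tuple R | forall i, B (lift ord0 i) (tnth t i)]); last first.
  apply/seteqP; split => [[x t] /= Bt|[x t] /= [Bx Bt] i].
    split; first exact: (Bt ord0).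
    by move=> i; have := Bt (lift ord0 i); rewrite tnthS.
  by case: (unliftP ord0 i) => [j|] ->; rewrite ?tnthS.
rewrite product_measure1E; last 2 first.
- exact: mB.
- exact: (measurable_box (fun i => mB (lift ord0 i))).
rewrite exprS EFinM; congr (_ * _)%E; first exact: Bc.
exact: (IH (fun i => B (lift ord0 i))).
Qed.

(** Fubini: the slices of [A] along coordinate [i] have at most one point. If [i] is not the first
    coordinate, fixing the first one leaves a set that is null by induction. *)
Lemma lebesgue_tuple_null k (A : set (k.-tuple R)) (i : 'I_k) : measurable A ->
    (forall s t, A s -> A t ->
       (forall j, j != i -> tnth s j = tnth t j) -> s = t) ->
  lebesgue_tuple A = 0%E.
Proof.
elim: k A i => [|k IH] A i mA Ai; first by case: i {Ai}.
have mA' : measurable (@cons_pair R k @^-1` A).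
  by rewrite -[_ @^-1` _]setTI; exact: measurable_cons_pair.
rewrite /= /pushforward.
case: (unliftP ord0 i) Ai => [j|] -> Ai.
  apply: integral0_eq => x _ /=; apply: (IH _ j); first exact: measurable_xsection.
  move=> s t /xsectionP As /xsectionP At st.
  have /(congr1 val)/= : cons_pair (x, s) = cons_pair (x, t).
    apply: Ai => // l; case: (unliftP ord0 l) => [l'|] -> // ll'.
    rewrite !tnthS /= ; apply: st; apply: contraNneq ll' => ->; exact: eqxx.
  by move=> [] /val_inj.
(* When [i] is the first coordinate, the one-point slices are those at a fixed tail, so the order of
   integration is exchanged. *)
rewrite (@product_measure_unique _ _ _ _ _ _ _ (lebesgue_measure \x^ @lebesgue_tuple R k)%E)//; last first.
  by move=> *; exact: product_measure2E.
rewrite /= /product_measure2; apply: integral0_eq => t _ /=.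
have [->|/set0P[x /ysectionP Ax]] := eqVneq (ysection (cons_pair (k := k) @^-1` A) t) set0.
  by rewrite measure0.
rewrite (_ : ysection _ t = [set x]) ?lebesgue_measure_set1//.
apply/seteqP; split => [y /ysectionP Ay|_ ->]; last exact/ysectionP.
have /(congr1 val)/= : cons_pair (y, t) = cons_pair (x, t).
  by apply: Ai => // l; case: (unliftP ord0 l) => [l'|] ->; rewrite ?eqxx// !tnthS.
by move=> [].
Qed.

End lebesgue_tuple_theory.

(** Variant of [big_ord_recr] that fits the case analysis by [unliftP ord_max]. *)
Lemma big_ord_recr_lift (T : Type) (idx : T) (op : Monoid.law idx) p
    (F : 'I_p.+1 -> T) :
  \big[op/idx]_i F i =
  op (\big[op/idx]_(j < p) F (lift ord_max j)) (F ord_max).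
Proof.
rewrite big_ord_recr/=; congr (op _ _); apply: eq_bigr => j _; congr F.
by apply/ord_inj; rewrite lift_max.
Qed.

Section measurable_comparison.
Context d (T : measurableType d) (R : realType) (f g : T -> R).
Hypotheses (mf : measurable_fun setT f) (mg : measurable_fun setT g).

Lemma measurable_set_lt : measurable [set x | f x < g x].
Proof.
rewrite -[X in measurable X]setTI.
exact: (measurable_fun_ltr mf mg measurableT (Y := [set true])).
Qed.

Lemma measurable_set_le : measurable [set x | f x <= g x].
Proof. by rewrite -[X in measurable X]setTI; exact: measurable_fun_le. Qed.

End measurable_comparison.

(** * The ordered simplex: its closure and the measurability of its chart *)

Section simplex.
Context {R : realType} (p : nat).
Implicit Types (y z : 'rV[R]_p.+1) (t : p.-tuple R).

Lemma simplex_point_lift t (j : 'I_p) :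
  simplex_point (m := p.+1) t 0 (lift ord_max j) = tnth t j.
Proof. by rewrite mxE lift_max (tnth_nth (1 - \sum_(x <- t) x)). Qed.

Lemma simplex_point_max t :
  simplex_point (m := p.+1) t 0 ord_max = 1 - \sum_i tnth t i.
Proof. by rewrite mxE nth_default ?size_tuple//= big_tuple. Qed.

(** Explicit form of the closure of [nabla], as [closure_nabla] shows. *)
Definition weak_nabla : set 'rV[R]_p.+1 :=
  [set y | [/\ forall i, 0 <= y 0 i,
               forall i j : 'I_p.+1, (i < j)%N -> y 0 j <= y 0 i &
               \sum_i y 0 i = 1]].

Lemma closed_weak_nabla : closed weak_nabla.
Proof.
have cy i : continuous (fun y : 'rV[R]_p.+1 => y 0 i) by exact: coord_continuous.
rewrite (_ : weak_nabla = \bigcap_i [set y | 0 <= y 0 i] `&`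
   (\bigcap_(ij in [set ij : 'I_p.+1 * 'I_p.+1 | (ij.1 < ij.2)%N])
     [set y | 0 <= y 0 ij.1 - y 0 ij.2] `&` [set y | \sum_i y 0 i = 1])); last first.
  apply/seteqP; split => [y [y0 yd y1]|y [y0 [yd y1]]].
    split => [i _|]; first exact: y0.
    by split => // -[i j] /= ij; rewrite subr_ge0 yd.
  split => // [i|i j ij]; first exact: y0.
  by rewrite -subr_ge0; exact: (yd (i, j)).
have cge (h : 'rV[R]_p.+1 -> R) : continuous h -> closed [set y | 0 <= h y].
  by move=> ch; apply: (@preimage_closed _ _ h [set x | 0 <= x]);
    [move=> y _; exact: ch|exact: closed_ge].
apply: closedI; last apply: closedI.
- by apply: closed_bigI => i _; exact: cge.
- apply: closed_bigI => ij _; apply: (cge (fun y => y 0 ij.1 - y 0 ij.2)) => y.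
  by apply: continuousB; [exact: (cy ij.1 y)|exact: (cy ij.2 y)].
- apply: (@preimage_closed _ _ (fun y => \sum_i y 0 i) [set x | x = 1]).
    move=> y _; apply: (@continuous_big _ _ +%R) => [|i _]; last exact: cy.
    exact: add_continuous.
  exact: closed_eq.
Qed.

Lemma nabla_nonempty : @nabla R p.+1 !=set0.
Proof.
(* The witness has coordinates proportional to p+1, p, ..., 1. *)
pose S : R := \sum_(i < p.+1) (p.+1 - i)%:R.
have a0 (i : 'I_p.+1) : 0 < (p.+1 - i)%:R :> R by rewrite ltr0n subn_gt0.
have S0 : 0 < S by rewrite /S (bigD1 ord0)//= ltr_pwDl// sumr_ge0.
exists (\row_i ((p.+1 - i)%:R / S)); split => [i|i j ij|].
- rewrite mxE; apply/andP; split; first by rewrite divr_ge0// ltW.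
  rewrite ler_pdivrMr// mul1r /S (bigD1 i)//= lerDl.
  by apply: sumr_ge0 => k _; exact/ltW.
- by rewrite !mxE ltr_pM2r ?invr_gt0// ltr_nat ltn_sub2l.
- under eq_bigr do rewrite mxE.
  by rewrite -mulr_suml divff// gt_eqF.
Qed.

Lemma ball_rowP y z (e : R) : 0 < e -> (forall i, `|y 0 i - z 0 i| < e) -> ball y e z.
Proof. by move=> e0 h; split => // i j; rewrite ord1; exact: h. Qed.

(** One inclusion holds because [weak_nabla] is closed. For the other, moving a point slightly
    towards a strictly ordered one makes all its inequalities strict. *)
Lemma closure_nabla : closure (@nabla R p.+1) = weak_nabla.
Proof.
apply/seteqP; split.
  rewrite ((closure_id weak_nabla).1 closed_weak_nabla).
  apply: closure_subset => y [y01 yd y1]; split => // [i|i j ij].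
    by have /andP[] := y01 i.
  by apply/ltW/yd.
move=> y [y0 yd y1] B /nbhs_ballP[e /= e0 eB].
have [z [z01 zd z1]] := nabla_nonempty.
(* [c <= 1] makes [w] a convex combination; [c < e] puts it in the ball, as coordinates in [0, 1]
   differ by at most 1. *)
pose c := Num.min 1 (e / 2).
have c0 : 0 < c by rewrite lt_min ltr01 divr_gt0.
have c1 : c <= 1 by rewrite ge_min lexx.
have ce : c < e by rewrite gt_min; apply/orP; right; lra.
have z0 i : 0 <= z 0 i by have /andP[] := z01 i.
have y_le1 i : y 0 i <= 1.
  by rewrite -y1 (bigD1 i)//= lerDl; exact: sumr_ge0.
pose w : 'rV[R]_p.+1 := (1 - c) *: y + c *: z.
have wE i : w 0 i = (1 - c) * y 0 i + c * z 0 i by rewrite !mxE.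
exists w; split; last first.
  apply: eB; apply: ball_rowP => // i; rewrite wE.
  apply: le_lt_trans ce.
  rewrite (_ : _ - _ = c * (y 0 i - z 0 i)); last by ring.
  rewrite normrM gtr0_norm// ler_piMr ?(ltW c0)//.
  have /andP[? ?] := z01 i; have := y_le1 i; have := y0 i.
  by rewrite ler_norml => *; apply/andP; split; lra.
have w0 i : 0 <= w 0 i by rewrite wE addr_ge0 ?mulr_ge0 ?subr_ge0// ltW.
have w1 : \sum_i w 0 i = 1.
  under eq_bigr do rewrite wE.
  by rewrite big_split/= -!mulr_sumr y1 z1 !mulr1 subrK.
split => // [i|i j ij].
  by rewrite w0 -w1 (bigD1 i)//= lerDl sumr_ge0.
by rewrite !wE ler_ltD ?ltr_pM2l ?zd// ler_wpM2l ?subr_ge0// yd.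
Qed.

Lemma sum_simplex_point t : \sum_i simplex_point (m := p.+1) t 0 i = 1.
Proof.
rewrite big_ord_recr_lift /= simplex_point_max.
by under eq_bigr do rewrite simplex_point_lift; rewrite addrC subrK.
Qed.

Lemma measurable_simplex_coord i :
  measurable_fun setT (fun t : p.-tuple R => simplex_point (m := p.+1) t 0 i).
Proof.
case: (unliftP ord_max i) => [j|] ->.
  rewrite (_ : (fun _ => _) = fun t => tnth t j); first exact: measurable_tnth.
  by apply/funext => t; exact: simplex_point_lift.
rewrite (_ : (fun _ => _) = fun t => 1 - \sum_i tnth t i); last first.
  by apply/funext => t; exact: simplex_point_max.
apply: measurable_funB => //; apply: measurable_sum => j; exact: measurable_tnth.
Qed.

Lemma measurable_simplex_point :
  measurable_fun setT (@simplex_point R p.+1 : _ -> borel 'rV[R]_p.+1).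
Proof.
(* U is the union of the rational balls that it contains. *)
apply: (@measurability _ _ _ (borel 'rV[R]_p.+1) _ _ (@open 'rV[R]_p.+1)) => //= _ [U oU <-]; rewrite setTI.
pose F (qn : 'rV[rat]_p.+1 * nat) : set (p.-tuple R) :=
  if `[< ball (map_mx ratr qn.1 : 'rV[R]_p.+1) qn.2.+1%:R^-1 `<=` U >] then
    \bigcap_(i in setT) [set t : p.-tuple R |
       `|ratr (qn.1 0 i) - simplex_point (m := p.+1) t 0 i| < qn.2.+1%:R^-1]
  else set0.
rewrite (_ : _ @^-1` U = \bigcup_qn F qn).
  apply: countable_bigcupT_measurable; first exact: countableP.
  move=> [q n]; rewrite /F; case: asboolP => // _.
  apply: fin_bigcap_measurable => // i _.
  apply: measurable_set_lt => //.
  apply: measurableT_comp => //; apply: measurable_funB => //.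
  exact: measurable_simplex_coord.
apply/seteqP; split => [t /= Ut|t [[q n] _]].
  have /nbhs_ballP[e /= e0 eU] : nbhs (simplex_point (m := p.+1) t) U.
    by move: oU; rewrite openE; exact.
  (* A ball of this radius, with rational center within the same distance of the point, contains the
     point and stays inside its [e]-ball. *)
  have [n ne] : exists n, n.+1%:R^-1 < e / 2.
    have e2 : 0 < (e / 2)^-1 by rewrite invr_gt0 divr_gt0.
    have /andP[_ ltn] := truncn_itv (ltW e2).
    exists (Num.truncn (e / 2)^-1); rewrite invf_plt ?posrE ?divr_gt0//.
  have n0 : 0 < n.+1%:R^-1 :> R by rewrite invr_gt0.
  have /choice[q qE] i : exists q : rat,
      `|ratr q - simplex_point (m := p.+1) t 0 i| < n.+1%:R^-1 :> R.
    have [|q] := @rat_in_itvoo R (simplex_point (m := p.+1) t 0 i) (simplex_point (m := p.+1) t 0 i + n.+1%:R^-1).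
      by rewrite ltrDl.
    rewrite in_itv/= => /andP[q1 q2]; exists q.
    by rewrite gtr0_norm ?subr_gt0// ltrBlDl.
  exists (\row_i q i, n) => //; rewrite /F /=; case: asboolP => [_ i _|] /=.
    by rewrite mxE; exact: qE.
  case=> z [_ qz]; apply: eU; apply: ball_rowP => // i.
  have qzi : `|ratr (q i) - z 0 i| < n.+1%:R^-1 by have := qz 0 i; rewrite !mxE.
  set s := simplex_point _ _ _.
  rewrite (_ : s - _ = - (ratr (q i) - s) + (ratr (q i) - z 0 i)); last by ring.
  apply: (le_lt_trans (ler_normD _ _)); rewrite normrN [e]splitr.
  by apply: ltrD; [exact: lt_trans (qE i) ne|exact: lt_trans qzi ne].
rewrite /F; case: asboolP => //= qU tq; apply: qU; apply: ball_rowP => // i.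
by rewrite mxE; exact: tq.
Qed.

Lemma measurable_nabla_chart : measurable (@nabla_chart R p.+1).
Proof.
pose y t := simplex_point (m := p.+1) t : 'rV[R]_p.+1.
(* Points of the chart have sum 1 by [sum_simplex_point], so only the inequalities cut out the
   domain. *)
rewrite (_ : @nabla_chart R p.+1 =
    \bigcap_i ([set t | 0 <= y t 0 i] `&` [set t | y t 0 i <= 1]) `&`
    \bigcap_(ij in [set ij : 'I_p.+1 * 'I_p.+1 | (ij.1 < ij.2)%N])
      [set t | y t 0 ij.2 < y t 0 ij.1]); last first.
  apply/seteqP; split => [t [y01 yd _]|t [y01 yd]].
    split => [i _|ij /yd//]; by have /andP[] := y01 i.
  split => [i|i j ij|]; last exact: sum_simplex_point.
  - by have [/= -> ->] := y01 i Logic.I.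
  - exact: (yd (i, j)).
apply: measurableI.
  apply: fin_bigcap_measurable => // i _; apply: measurableI;
    apply: measurable_set_le => //;
    exact: measurable_simplex_coord.
apply: fin_bigcap_measurable => [|ij _]; first exact: finite_finset.
apply: measurable_set_lt;
  exact: measurable_simplex_coord.
Qed.

End simplex.

(** * Partitions of N and the grid cells they label *)

Section cells.
Context {R : realType} (p : nat).

(* The last part of k is determined by the others when k is a partition of N,
   so only the first p parts enter. *)
Definition cell N (k : p.+1.-tuple 'I_N.+1) : set (p.-tuple R) :=
  [set t | forall j : 'I_p,
    [set` `[(tnth k (lift ord_max j))%:R / N%:R,
            (tnth k (lift ord_max j)).+1%:R / N%:R[ ] (tnth t j)].

Lemma measurable_cell N (k : p.+1.-tuple 'I_N.+1) : measurable (cell k).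
Proof.
exact: (measurable_box (B := fun j : 'I_p =>
    [set` `[(tnth k (lift ord_max j))%:R / N%:R,
            (tnth k (lift ord_max j)).+1%:R / N%:R[ ])).
Qed.

Lemma lebesgue_tuple_cell N (k : p.+1.-tuple 'I_N.+1) : (0 < N)%N ->
  lebesgue_tuple (cell k) = (N%:R^-1 ^+ p)%:E.
Proof.
move=> N0; apply: (lebesgue_tuple_cube (B := fun j : 'I_p =>
    [set` `[(tnth k (lift ord_max j))%:R / N%:R,
            (tnth k (lift ord_max j)).+1%:R / N%:R[ ])) => //= j.
rewrite lebesgue_measure_itv/= lte_fin ltr_pM2r ?invr_gt0 ?ltr0n// ltr_nat ltnSn.
by rewrite -EFinB -mulrBl -natrB// subSnn mul1r.
Qed.

Lemma partitionsP N (k : p.+1.-tuple 'I_N.+1) :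
  reflect ((forall i j : 'I_p.+1, (i < j)%N -> (tnth k j <= tnth k i)%N) /\
           (\sum_i tnth k i = N)%N)
          (k \in partitions N p.+1).
Proof.
have nthE (i : 'I_p.+1) : nth 0%N [seq val x | x <- k] i = tnth k i.
  by rewrite (nth_map ord0) ?size_tuple// -tnth_nth.
rewrite inE; apply: (iffP andP) => [[/= ks /eqP k1]|[ks k1]]; split => //.
- move=> i j ij; rewrite -!nthE.
  have gt : transitive geq by move=> a b c /= ? ?; apply: leq_trans; eassumption.
  by apply: (sorted_leq_nth gt leqnn _ ks) (ltnW ij);
    rewrite inE size_map size_tuple.
- apply/(sortedP 0%N) => i; rewrite size_map size_tuple => ip.
  by rewrite (nthE (Ordinal ip)) (nthE (Ordinal (ltnW ip))) /=; exact: ks.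
- exact/eqP.
Qed.

Section positive.
Variable N : nat.
Hypothesis N0 : (0 < N)%N.
Implicit Types (k : p.+1.-tuple 'I_N.+1) (t : p.-tuple R).

Let NR0 : 0 < N%:R :> R. Proof. by rewrite ltr0n. Qed.

Lemma cell_bounds k t (j : 'I_p) : cell k t ->
  (tnth k (lift ord_max j))%:R / N%:R <= tnth t j <
  (tnth k (lift ord_max j))%:R / N%:R + N%:R^-1.
Proof. by move=> /(_ j) /=; rewrite in_itv/= -natr1 mulrDl mul1r. Qed.

(** Rounding down the numbers N t_j recovers the first [p] parts, and the sum N then fixes the last
    one. *)
Lemma cell_inj k k' t : k \in partitions N p.+1 -> k' \in partitions N p.+1 ->
  cell k t -> cell k' t -> k = k'.
Proof.
move=> /partitionsP[_ k1] /partitionsP[_ k'1] kt k't.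
have E j : tnth k (lift ord_max j) = tnth k' (lift ord_max j) :> nat.
  have H (l : p.+1.-tuple 'I_N.+1) : cell l t ->
      Num.truncn (tnth t j * N%:R) = tnth l (lift ord_max j) :> nat.
    move=> /(_ j) /=; rewrite in_itv/= => /andP[a b]; apply: truncn_def.
    by rewrite -ler_pdivrMr// a -ltr_pdivlMr.
  by rewrite -(H k)// -(H k').
apply/eq_from_tnth => i; apply/val_inj => /=.
case: (unliftP ord_max i) => [j|] -> //.
have SE : (\sum_(j < p) tnth k (lift ord_max j) =
           \sum_(j < p) tnth k' (lift ord_max j))%N.
  by apply: eq_bigr => j _; exact: E.
move: k1 k'1; rewrite !big_ord_recr_lift/= -SE => k1 k'1.
by apply: (@addnI (\sum_(j < p) tnth k (lift ord_max j))%N); rewrite k1 k'1.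
Qed.

Lemma sum_normalized_parts k : k \in partitions N p.+1 ->
  \sum_i normalized_parts k 0 i = 1 :> R.
Proof.
move=> /partitionsP[_ k1]; under eq_bigr do rewrite mxE.
by rewrite -mulr_suml -natr_sum k1 divff// gt_eqF.
Qed.

Lemma weak_nabla_normalized_parts k : k \in partitions N p.+1 ->
  weak_nabla (normalized_parts k : 'rV[R]_p.+1).
Proof.
move=> kp; split; last exact: sum_normalized_parts.
  by move=> i; rewrite mxE divr_ge0.
move/partitionsP : kp => [kd _] i j ij.
by rewrite !mxE ler_pM2r ?invr_gt0// ler_nat kd.
Qed.

(** Each chart coordinate is off by less than 1/N. The error of the last coordinate is minus the sum
    of the others, hence at most p/N; p+1 makes the bound strict. *)
Lemma cell_ball k t : k \in partitions N p.+1 -> cell k t ->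
  ball (simplex_point (m := p.+1) t) (p.+1%:R / N%:R) (normalized_parts k).
Proof.
move=> kp kt; apply: ball_rowP => [|i]; first by rewrite divr_gt0.
have V0 : 0 < N%:R^-1 :> R by rewrite invr_gt0.
have H j : `|tnth t j - normalized_parts k 0 (lift ord_max j)| < N%:R^-1.
  by have := cell_bounds j kt; rewrite mxE ltr_norml => /andP[? ?]; apply/andP; split; lra.
case: (unliftP ord_max i) => [j|] ->.
  rewrite simplex_point_lift (lt_le_trans (H j))// -[leLHS]mul1r ler_pM2r//.
  by rewrite ler1n.
have := sum_normalized_parts kp; rewrite big_ord_recr_lift/=.
move=> /(canRL (addKr _)) ->; rewrite simplex_point_max.
rewrite (_ : _ - _ = \sum_j (normalized_parts k 0 (lift ord_max j) - tnth t j)); last first.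
  by rewrite sumrB; ring.
apply: le_lt_trans (ler_norm_sum _ _ _) _.
apply: (@le_lt_trans _ _ (\sum_(j < p) N%:R^-1)).
  by apply: ler_sum => j _; rewrite distrC ltW.
by rewrite sumr_const card_ord -[ltLHS]mulr_natl ltr_pM2r// ltr_nat.
Qed.

(** Since parts are at most N, all cells lie in a box independent of N, which will carry the
    dominating function. *)
Lemma cell_sub k t (j : 'I_p) : cell k t -> tnth t j \in `[0, 2].
Proof.
move=> /(_ j) /=; rewrite !in_itv/= => /andP[a b]; apply/andP; split.
  by apply: le_trans a; rewrite divr_ge0.
apply/ltW/(lt_le_trans b); rewrite ler_pdivrMr// -natrM ler_nat.
rewrite mul2n -addnn -addn1 leq_add//.
by rewrite -ltnS.
Qed.

End positive.

(** Round each N t_j down and give the remainder to the last part. Only the order between the last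
    part and the others is in danger, and the strict gap at [t] protects it for large N. *)
Lemma cell_exists (t : p.-tuple R) : nabla_chart (m := p.+1) t ->
  \forall N \near \oo, exists2 k, k \in partitions N p.+1 & @cell N k t.
Proof.
move=> [y01 yd y1].
pose last := simplex_point (m := p.+1) t 0 ord_max.
have t0 j : 0 <= tnth t j.
  by rewrite -simplex_point_lift; have /andP[] := y01 (lift ord_max j).
have last0 : 0 <= last by have /andP[] := y01 ord_max.
have gap j : 0 < tnth t j - last.
  by rewrite subr_gt0 -simplex_point_lift; apply: yd; rewrite lift_max /=.
(* Rounding raises the last part to at most N [last] + p and lowers any other part by less than 1,
   so a gap of p+1 suffices. *)
have : \forall N \near \oo, forall j : 'I_p, p.+1%:R <= N%:R * (tnth t j - last).
  apply: filter_forall => j; near=> N.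
  rewrite -ler_pdivrMr//; near: N; exact: nbhs_infty_ger.
apply: filter_app; near=> N => NP.
have N0 : (0 < N)%N by near: N; exact: nbhs_infty_gt.
have NR0 : 0 < N%:R :> R by rewrite ltr0n.
pose a (j : 'I_p) := Num.truncn (tnth t j * N%:R).
have aE j : (a j)%:R <= tnth t j * N%:R < (a j)%:R + 1.
  by rewrite natr1; apply: truncn_itv; rewrite mulr_ge0.
have sumt : \sum_j tnth t j = 1 - last by rewrite /last simplex_point_max opprB addrC subrK.
have sa : (\sum_j a j <= N)%N.
  rewrite -(ler_nat R) natr_sum.
  apply: (@le_trans _ _ (\sum_j tnth t j * N%:R)).
    by apply: ler_sum => j _; have /andP[] := aE j.
  by rewrite -mulr_suml sumt ler_piMl// gerBl.
have saN j : (a j <= N)%N by apply: leq_trans sa; rewrite (bigD1 j)//= leq_addr.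
pose F (i : 'I_p.+1) := if unlift ord_max i is Some j then a j else (N - \sum_j a j)%N.
have FN i : (F i <= N)%N by rewrite /F; case: unliftP => // _; exact: leq_subr.
pose k : p.+1.-tuple 'I_N.+1 := [tuple inord (F i) | i < p.+1].
have kE i : tnth k i = F i :> nat by rewrite tnth_mktuple inordK// ltnS.
have Fl j : F (lift ord_max j) = a j by rewrite /F liftK.
have Fm : F ord_max = (N - \sum_j a j)%N by rewrite /F unlift_none.
exists k.
  apply/partitionsP; split; last first.
    rewrite big_ord_recr_lift/= kE Fm.
    by under eq_bigr do rewrite kE Fl; rewrite subnKC.
  move=> i j ij; rewrite !kE.
  case: (unliftP ord_max i) ij => [i'|] ->; last first.
    by rewrite /= ltnNge -ltnS ltn_ord.
  case: (unliftP ord_max j) => [j'|] ->; rewrite !lift_max ?Fl => ij.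
    apply: le_truncn; rewrite ler_pM2r//.
    by rewrite -!simplex_point_lift; apply/ltW/yd; rewrite !lift_max.
  rewrite Fm -(ler_nat R) natrB// natr_sum.
  have /andP[_ ai] := aE i'.
  have : \sum_j tnth t j * N%:R <= \sum_j ((a j)%:R + 1) :> R.
    by apply: ler_sum => l _; have /andP[_ /ltW] := aE l.
  rewrite -mulr_suml sumt big_split/= sumr_const card_ord.
  have := NP i'; rewrite -[p.+1]addn1 natrD => h1 h2.
  set S := \sum_j (a j)%:R in h2 *.
  set A := (a i')%:R in ai *.
  nra.
move=> j /=; rewrite in_itv/= kE Fl ler_pdivrMr// ltr_pdivlMr//.
exact: truncn_itv (mulr_ge0 _ _).
Unshelve. all: end_near. Qed.

End cells.

Lemma integrable_indic_lty d (T : measurableType d) (R : realType)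
    (mu : {measure set T -> \bar R}) (A : set T) :
    measurable A -> (mu A < +oo)%E ->
  mu.-integrable setT (fun x => (\1_A x)%:E).
Proof.
move=> mA Aoo; apply/integrableP; split; first exact/measurable_EFinP.
under eq_integral do rewrite gee0_abs ?lee_fin//.
by rewrite integral_indic// setIT.
Qed.

(** * Convergence of Riemann sums over partitions *)

Section riemann_sums.
Context {R : realType} (p : nat).
Implicit Types (t : p.-tuple R).

(** There are finitely many pairs of indices. The smaller index of a pair is never the last, so it
    names a chart coordinate along which [lebesgue_tuple_null] applies. *)
Lemma simplex_point_ae_neq :
  {ae @lebesgue_tuple R p, forall t, forall i j : 'I_p.+1, (i < j)%N ->
    simplex_point (m := p.+1) t 0 i != simplex_point (m := p.+1) t 0 j}.
Proof.
apply: filter_forall => i; apply: filter_forall => j.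
case: (ltnP i j) => [ij|_]; last exact: nearW.
case: (unliftP ord_max i) ij => [i'|] ->; last first.
  by rewrite /= ltnNge -ltnS ltn_ord.
move=> ij; pose d t := simplex_point (m := p.+1) t 0 (lift ord_max i') -
                       simplex_point (m := p.+1) t 0 j.
exists (d @^-1` [set 0]); split.
- rewrite -[_ @^-1` _]setTI; apply: (measurable_funB _ _) => //;
    exact: measurable_simplex_coord.
- apply: (lebesgue_tuple_null (i := i')).
    rewrite -[_ @^-1` _]setTI; apply: (measurable_funB _ _) => //;
    exact: measurable_simplex_coord.
  (* If j is the last index, y_j = 1 - t_i' - (the other coordinates), so that
     y_i' = y_j still determines t_i'. *)
  move=> s t; rewrite /d /= !simplex_point_lift => s0 t0 st.
  apply: eq_from_tnth => l; have [->|/st//] := eqVneq l i'.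
  move: s0 t0; case: (unliftP ord_max j) ij => [j'|] -> ij.
    rewrite !simplex_point_lift => s0 t0.
    have E : tnth s j' = tnth t j'.
      by apply: st; apply: contraTneq ij => ->; rewrite ltnn.
    by move: s0 t0; rewrite E => /subr0_eq -> /subr0_eq ->.
  rewrite !simplex_point_max.
  have D (u : p.-tuple R) : \sum_i tnth u i = tnth u i' + \sum_(l | l != i') tnth u l.
    by rewrite (bigD1 i').
  have E : \sum_(l | l != i') tnth s l = \sum_(l | l != i') tnth t l.
    by apply: eq_bigr => l' /st.
  rewrite !D E; set S := \sum_(_ | _) _; move=> s0 t0; lra.
- move=> t /= /not_implyP[_] /negP; rewrite negbK => /eqP E.
  by rewrite /d E subrr.
Qed.

Definition step_sum (F : 'rV[R]_p.+1 -> R) N t : R :=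
  \sum_(k in partitions N p.+1) F (normalized_parts k) * \1_(cell k) t.

Lemma step_sum_cell F N (k : p.+1.-tuple 'I_N.+1) t : (0 < N)%N ->
  k \in partitions N p.+1 -> cell k t -> step_sum F N t = F (normalized_parts k).
Proof.
move=> N0 kp kt; rewrite /step_sum (bigD1 k)//= indicE mem_set// mulr1.
rewrite big1 ?addr0// => k' /andP[k'p k'k]; rewrite indicE memNset ?mulr0//.
by move=> k't; move/eqP: k'k; apply; exact: cell_inj k'p kp k't kt.
Qed.

Lemma step_sum_out F N t :
    (forall k : p.+1.-tuple 'I_N.+1, k \in partitions N p.+1 -> ~ cell k t) ->
  step_sum F N t = 0.
Proof.
by move=> kt; apply: big1 => k /kt nkt; rewrite indicE memNset ?mulr0.
Qed.

Lemma measurable_step_sum F N : measurable_fun setT (step_sum F N).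
Proof.
rewrite /step_sum; under eq_fun do rewrite big_mkcond.
apply: measurable_sum => k.
case: (k \in partitions N p.+1); last exact: measurable_cst.
by apply: measurable_funM => //; apply: measurable_indic; exact: measurable_cell.
Qed.

Lemma integral_step_sum F N : (0 < N)%N ->
  (\int[@lebesgue_tuple R p]_t (step_sum F N t)%:E =
   ((\sum_(k in partitions N p.+1) F (normalized_parts k)) * N%:R^-1 ^+ p)%:E)%E.
Proof.
move=> N0; under eq_integral do rewrite -sumEFin.
have icell k : (@lebesgue_tuple R p).-integrable setT (EFin \o \1_(@cell R p N k)).
  apply: integrable_indic_lty; first exact: measurable_cell.
  by rewrite [X in (X < _)%E]lebesgue_tuple_cell// ltry.
rewrite integral_sum//; last first.
  move=> k; under eq_fun do rewrite EFinM.
  by apply: integrableZl => //; exact: icell.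
rewrite mulr_suml -sumEFin; apply: eq_bigr => k _.
under eq_integral do rewrite EFinM.
rewrite integralZl//; last exact: icell.
rewrite [RHS]EFinM; congr (_ * _)%E.
rewrite -(lebesgue_tuple_cell k N0) -[in RHS](setIT (cell k)).
by apply: integral_indic => //; exact: measurable_cell.
Qed.

Variables (F : 'rV[R]_p.+1 -> R) (M : R).
Hypotheses (FM : forall y, closure (@nabla R p.+1) y -> `|F y| <= M)
  (Fc : {within closure (@nabla R p.+1), continuous F})
  (mF : measurable_fun (@nabla_chart R p.+1) (F \o @simplex_point R p.+1)).

(** Inside the chart domain, [t] eventually lies in a cell whose label tends to the point of [t],
    and continuity of [F] on the closure concludes. Elsewhere [t] eventually lies in no cell. *)
Lemma step_sum_cvg t :
    (forall i j : 'I_p.+1, (i < j)%N ->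
      simplex_point (m := p.+1) t 0 i != simplex_point (m := p.+1) t 0 j) ->
  step_sum F N t @[N --> \oo] -->
    ((F \o @simplex_point R p.+1) \_ (nabla_chart (m := p.+1))) t.
Proof.
move=> tne; rewrite patchE; case: ifPn => [/[!inE] tn|/negP].
  apply/cvgrPdist_lt => e e0.
  have /cvgrPdist_lt/(_ e e0)/= := (subspace_continuousP _ _).1 Fc _ (subset_closure tn).
  rewrite near_withinE => /nbhs_ballP[d /= d0 dF].
  near=> N.
  have N0 : (0 < N)%N by near: N; exact: nbhs_infty_gt.
  have [k kp kt] : exists2 k, k \in partitions N p.+1 & @cell R p N k t.
    by near: N; exact: cell_exists.
  rewrite (step_sum_cell _ _ kp)//; apply: dF; last first.
    by rewrite closure_nabla; exact: weak_nabla_normalized_parts.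
  apply: le_ball (cell_ball N0 kp kt).
  rewrite ler_pdivrMr ?ltr0n// mulrC -ler_pdivrMr//; near: N; exact: nbhs_infty_ger.
(* Without ties weak order is strict order, so a point outside [nabla] is also outside its
   closure. *)
rewrite inE => tn; have tK : ~ closure (@nabla R p.+1) (simplex_point (m := p.+1) t).
  rewrite closure_nabla => -[y0 yd y1]; apply: tn; split => // [i|i j ij].
    by rewrite y0 -y1 (bigD1 i)//= lerDl sumr_ge0.
  by rewrite lt_neqAle yd// andbT eq_sym tne.
have : nbhs (simplex_point (m := p.+1) t) (~` closure (@nabla R p.+1)).
  by apply: open_nbhs_nbhs; split => //; apply: closed_openC; exact: closed_closure.
move=> /nbhs_ballP[d /= d0 dK].
(* A cell around [t] would bring a point of the closed simplex within (p+1)/N of it, hence into the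
   ball of radius [d]. *)
apply: cvg_near_cst; near=> N; apply: step_sum_out => k kp kt.
have N0 : (0 < N)%N by near: N; exact: nbhs_infty_gt.
apply: (dK (normalized_parts k)); last first.
  by rewrite closure_nabla; exact: weak_nabla_normalized_parts.
apply: le_ball (cell_ball N0 kp kt).
rewrite ler_pdivrMr ?ltr0n// mulrC -ler_pdivrMr//; near: N; exact: nbhs_infty_ger.
Unshelve. all: end_near. Qed.

(** Dominated convergence with bound [M] on the box [0, 2]^p. The index is shifted to [N.+1] so that
    no step divides by 0. *)
Lemma riemann_sum_cvg :
  let I := (\int[@lebesgue_tuple R p]_(t in nabla_chart (m := p.+1))
    (F (simplex_point (m := p.+1) t))%:E)%E in
  I \is a fin_num /\
  (\sum_(k in partitions N.+1 p.+1) F (normalized_parts k)) *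
    N.+1%:R^-1 ^+ p @[N --> \oo] --> fine I.
Proof.
pose box := [set t : p.-tuple R | forall j, tnth t j \in `[0 : R, 2]].
have mbox : measurable box.
  by apply: (measurable_box (B := fun j : 'I_p => [set` `[0 : R, 2]])).
pose f := (F \o @simplex_point R p.+1) \_ (nabla_chart (m := p.+1)).
have [] := @dominated_convergence _ _ _ (@lebesgue_tuple R p) setT measurableT
  (fun N t => (step_sum F N.+1 t)%:E) (EFin \o f) (fun t => M%:E * (\1_box t)%:E)%E.
- by move=> N; apply/measurable_EFinP; exact: measurable_step_sum.
- apply/measurable_EFinP; rewrite /f.
  by apply/(measurable_restrictT _ _).1 => //; exact: measurable_nabla_chart.
- have := simplex_point_ae_neq; apply: filterS => t tne _.
  apply: cvg_EFin; first exact: nearW.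
  rewrite /comp/=.
  rewrite (cvg_shiftS (fun N => step_sum F N t)); exact: step_sum_cvg.
- apply: integrableZl => //; apply: integrable_indic_lty => //.
  rewrite (_ : _ box = (2 ^+ p)%:E) ?ltry//.
  apply: (lebesgue_tuple_cube (B := fun j : 'I_p => [set` `[0 : R, 2]])) => // j.
  by rewrite lebesgue_measure_itv/= lte_fin ltr0n/= oppr0 adde0.
- apply: nearW => t N _; rewrite -EFinM lee_fin.
  have [[k [kp kt]]|nk] := pselect (exists k, k \in partitions N.+1 p.+1 /\ @cell R p N.+1 k t).
    rewrite (step_sum_cell _ _ kp)// indicE mem_set ?mulr1.
      by apply: FM; rewrite closure_nabla; exact: weak_nabla_normalized_parts.
    by move=> j; exact: cell_sub kt.
  rewrite step_sum_out ?normr0.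
    (* [M] is nonnegative because it bounds a norm at some point of [nabla]. *)
    rewrite mulr_ge0//; have [y yn] := @nabla_nonempty R p.
    by apply: le_trans (FM (subset_closure yn)).
  by move=> k kp kt; apply: nk; exists k.
move=> fi _ cf; rewrite /= integral_mkcond.
rewrite (_ : _ \_ _ = EFin \o f); last first.
  by apply/funext => t; rewrite /f /= !patchE; case: ifP.
have fin : (\int[@lebesgue_tuple R p]_t (EFin \o f) t)%E \is a fin_num.
  exact: integrable_fin_num.
split => //; rewrite -(fineK fin) in cf; move/fine_cvg : cf.
under eq_cvg do rewrite /= integral_step_sum//=.
exact.
Qed.

End riemann_sums.

Lemma continuous_borel_measurable (R : realType) (T : ptopologicalType)
    (g : T -> R) : continuous g -> measurable_fun setT (g : borel T -> R).
Proof.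
move=> /continuousP cg; apply: (measurability _ (RGenOpens.measurableE R)).
move=> _ [_ [a [b ->] <-]]; rewrite setTI; apply: sub_sigma_algebra.
by apply: cg; exact: interval_open.
Qed.

(** * Weak convergence of the partition laws *)

Section main.
Context {R : realType} (p : nat) (f : 'rV[R]_p.+1 -> R).
Hypotheses (hf : is_simplex_density f)
  (hc : {within closure (@nabla R p.+1), continuous f}).

(** A negative value would persist, by continuity, at nearby points of [nabla]. Partitions with
    equal or zero parts make the boundary matter. *)
Lemma density_closure_ge0 y : closure (@nabla R p.+1) y -> 0 <= f y.
Proof.
move=> yK; rewrite leNgt; apply/negP => fy0.
have /cvgrPdist_lt/(_ (- f y)) := (subspace_continuousP _ _).1 hc _ yK.
rewrite oppr_gt0 near_withinE => /(_ fy0) /yK[z [zn /= /(_ (subset_closure zn))]].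
rewrite ltr_norml opprK => /andP[+ _].
by rewrite ltrBrDl gtrDr ltNge; have [_ ->] := hf.
Qed.

Lemma integral_simplex_law (g : 'rV[R]_p.+1 -> R) : continuous g ->
  (\int[simplex_law f]_x (g x)%:E =
   \int[@lebesgue_tuple R p]_(t in nabla_chart (m := p.+1))
     (g (simplex_point (m := p.+1) t) * f (simplex_point (m := p.+1) t))%:E)%E.
Proof.
move=> /continuous_borel_measurable mg; have [mf f0 _] := hf.
have w0 t : nabla_chart (m := p.+1) t -> 0 <= f (simplex_point (m := p.+1) t).
  exact: f0.
exact: (@integral_density_image _ _ _ _ R (@lebesgue_tuple R p) _ _
  (f \o @simplex_point R p.+1) (@measurable_simplex_point R p)
  (@measurable_nabla_chart R p) mf w0 g mg).
Qed.

(** If the normalizing sum is 0, so is its inverse, and both sides vanish. *)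
Lemma integral_partition_law (g : 'rV[R]_p.+1 -> R) N : (0 < N)%N -> continuous g ->
  (\int[partition_law f N]_x (g x)%:E =
  ((\sum_(k in partitions N p.+1) f (normalized_parts k))^-1 *
   (\sum_(k in partitions N p.+1) g (normalized_parts k) * f (normalized_parts k)))%:E)%E.
Proof.
move=> N0 /continuous_borel_measurable mg.
have f0 k : k \in partitions N p.+1 -> 0 <= f (normalized_parts k).
  move=> kp; apply: density_closure_ge0; rewrite closure_nabla.
  exact: weak_nabla_normalized_parts.
rewrite [LHS](@integral_finite_law _ (borel 'rV[R]_p.+1) _ _ (partitions N p.+1)
    (@partition_prob _ _ f N) (fun k => normalized_parts k)) //.
  rewrite mulr_sumr; congr EFin; apply: eq_bigr => k _.
  by rewrite /partition_prob -mulrA [f _ * _]mulrC.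
move=> k kp; rewrite /partition_prob mulr_ge0 ?f0// invr_ge0.
by apply: sumr_ge0 => l; exact: f0.
Qed.

Lemma partition_law_cvg : [bounded f y | y in closure (@nabla R p.+1)] ->
  weak_cvg (partition_law f) (simplex_law f).
Proof.
(* Boundedness provides every bound strictly above [M0], whence the [+ 1]. *)
move=> [M0 [_ /(_ (M0 + 1))]]; rewrite ltrDl ltr01 => /(_ isT) fM g cg.
move=> [M' [_ /(_ (M' + 1))]]; rewrite ltrDl ltr01 => /(_ isT) gM'.
have [mf _ f1] := hf.
have [_] := riemann_sum_cvg fM hc mf; rewrite f1 /= => vcvg.
have [|||Ifin ucvg] := @riemann_sum_cvg R p (g \* f) ((M' + 1) * (M0 + 1)).
- move=> y yK; rewrite normrM ler_pM//; first exact: gM'.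
  exact: fM.
- apply/subspace_continuousP => y yK; apply: cvgM.
    by apply: cvg_within_filter; exact: cg.
  exact: (subspace_continuousP _ _).1 hc _ yK.
- apply: measurable_funM => //; apply: measurable_funTS.
  exact: (measurableT_comp (continuous_borel_measurable cg) (@measurable_simplex_point R p)).
rewrite integral_simplex_law// -(cvg_shiftS (fun N => \int[partition_law f N]_x (g x)%:E)%E).
rewrite -(fineK Ifin); apply: cvg_EFin.
  by apply: nearW => N; rewrite /= integral_partition_law.
pose S (h : 'rV[R]_p.+1 -> R) N :=
  (\sum_(k in partitions N.+1 p.+1) h (normalized_parts k)) * N.+1%:R^-1 ^+ p.
(* The volume factors of the two Riemann sums cancel in the quotient, whose denominator tends to
   1. *)
rewrite (_ : fine \o _ = fun N => S (g \* f) N * (S f N)^-1).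
  rewrite -[fine _]mulr1 -[X in _ * X]invr1; apply: cvgM; first exact: ucvg.
  by apply: cvgV; [exact: oner_neq0|exact: vcvg].
apply/funext => N; rewrite /= integral_partition_law//= /S invfM mulrACA.
by rewrite divff ?mulr1 1?mulrC// expf_neq0// invr_eq0 pnatr_eq0.
Qed.

End main.

Theorem theorem3 (R : realType) (m : nat) (hm : (2 <= m)%N)
    (f : 'rV[R]_m -> R) (hf : is_simplex_density f)
    (hbounded : [bounded f y | y in closure (@nabla R m)])
    (hcont : {within closure (@nabla R m), continuous f}) :
  weak_cvg (partition_law f) (simplex_law f).
Proof.
(* With [m] equal to [p.+1], the chart dimension [m.-1] computes to [p]. *)
case: m hm f hf hbounded hcont => // p _ f hf hbounded hcont.
exact: partition_law_cvg.
Qed.
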